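(* Let $\xi$ be a smooth vector field on a geodesically convex set $\mathcal M\subset\mathbb R^n$ with respect to $(\mathbb R^n,(\cdot,\cdot))$. Then: (i) if $\xi$ is locally iso-monotone on $\mathcal M$, then $\xi$ is iso-monotone on $\mathcal M$; (ii) if $\xi$ is locally $\alpha$-strongly iso-monotone on $\mathcal M$, then $\xi$ is $\alpha$-strongly iso-monotone on $\mathcal M$; (iii) if $\xi$ is locally $L$-iso-Lipschitz on $\mathcal M$, then $\xi$ is $L$-iso-Lipschitz on $\mathcal M$.
   Context: Let $(\mathbb R^n,(\cdot,\cdot))$ be a Riemannian structure on $\mathbb R^n$ (a smooth metric tensor field) with Levi-Civita connection $\nabla$. Tangent spaces are identified with $\mathbb R^n$; $(\cdot,\cdot)_2$ and $\|\cdot\|_2$ denote the Euclidean inner product and norm. For $x,y\in\mathbb R^n$, $\gamma_{x,y}:[0,1]\to\mathbb R^n$ denotes the (assumed unique) length-minimizing Riemannian geodesic from $x$ to $y$, $\log_x(y):=\dot\gamma_{x,y}(0)$ the Riemannian logarithm (so $\dot\gamma_{x,y}(1)=-\log_y(x)$), and $\mathcal P_{y\leftarrow x}$ parallel transport along the geodesic from $x$ to $y$. A set $\mathcal M\subset\mathbb R^n$ is geodesically convex if $\gamma_{x,y}([0,1])\subset\mathcal M$ for all $x,y\in\mathcal M$; a vector field on $\mathcal M$ assigns smoothly to each $x\in\mathcal M$ a vector $\xi_x\in T_x\mathcal M\subset\mathbb R^n$. Iso-distance $d^{\mathrm{iso}}(x,y):=\int_0^1\|\dot\gamma_{x,y}(s)\|_2\,\mathrm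 ds$; iso-logarithm $\log^{\mathrm{iso}}_x(y):=\frac{d^{\mathrm{iso}}(x,y)}{\|\log_x(y)\|_2}\log_x(y)$; iso-parallel transport $\mathcal P^{\mathrm{iso}}_{y\leftarrow x}\eta:=\frac{\|\log_x(y)\|_2}{\|\log_y(x)\|_2}\mathcal P_{y\leftarrow x}\eta$. Iso-connection along a geodesic $\gamma$: $\nabla^{\mathrm{iso}}_{\dot\gamma(t)}\xi:=\frac{1}{\|\dot\gamma(t)\|_2}\frac{D}{dt}\big(\|\dot\gamma(t)\|_2\,\xi_{\gamma(t)}\big)$, $D/dt$ the Levi-Civita covariant derivative along $\gamma$. Definitions (all for every $x\neq y\in\mathcal M$): $\xi$ is iso-monotone if $(\xi_y-\mathcal P^{\mathrm{iso}}_{y\leftarrow x}\xi_x,\ \mathcal P^{\mathrm{iso}}_{y\leftarrow x}\log^{\mathrm{iso}}_x(y))_2\ge0$; $\alpha$-strongly iso-monotone ($\alpha\ge0$) if this inner product is $\ge\alpha\, d^{\mathrm{iso}}(x,y)^2$; $L$-iso-Lipschitz ($L\ge0$) if $\|\xi_y-\mathcal P^{\mathrm{iso}}_{y\leftarrow x}\xi_x\|_2\le L\,d^{\mathrm{iso}}(x,y)$. Local versions (for every $x\neq y\in\mathcal M$ and every $t\in[0,1]$): locally iso-monotone if $(\mathcal P_{y\leftarrow\gamma_{x,y}(t)}\nabla^{\mathrm{iso}}_{\dot\gamma_{x,y}(t)}\xi,\ \mathcal P_{y\leftarrow x}\log_x(y))_2\ge0$; locally $\alpha$-strongly iso-monotone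 if this quantity is $\ge\alpha\|\log_y(x)\|_2^2$; locally $L$-iso-Lipschitz if $\|\mathcal P_{y\leftarrow\gamma_{x,y}(t)}\nabla^{\mathrm{iso}}_{\dot\gamma_{x,y}(t)}\xi\|_2\le L\|\log_y(x)\|_2$. *)

(* Defs.v *)
From HB Require Import structures.
From mathcomp Require Import all_boot all_order all_algebra.
From mathcomp Require Import all_classical all_reals all_analysis.
Set Implicit Arguments. Unset Strict Implicit. Unset Printing Implicit Defensive.
Import Order.TTheory GRing.Theory Num.Theory.
Import numFieldNormedType.Exports.
Local Open Scope classical_set_scope.
Local Open Scope ring_scope.

Section Iso.
Context {R : realType}.

(** C^k on a set D (used with D open): all iterated directional derivatives
    up to order k exist (differentiability) and the k-th ones are continuous. *)
Fixpoint Ck {U W : normedModType R} (D : set U) (k : nat) (f : U -> W) : Prop :=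
  match k with
  | 0 => forall x, D x -> {for x, continuous f}
  | k'.+1 => (forall x, D x -> differentiable f x) /\
             forall v : U, Ck D k' (fun x => 'D_v f x)
  end.

Definition smooth_on {U W : normedModType R} (D : set U) (f : U -> W) : Prop :=
  forall k, Ck D k f.

Context {n : nat}.
Notation V := 'rV[R]_n.

Definition dot2 (u v : V) : R := (u *m v^T) 0 0.
Definition norm2 (u : V) : R := Num.sqrt (dot2 u u).

Definition ebasis (i : 'I_n) : V := delta_mx 0 i.

Definition riemannian_metric (g : V -> 'M[R]_n) : Prop :=
  (forall i j, smooth_on setT (fun x => g x i j)) /\
  (forall x, (g x)^T = g x) /\
  (forall x (v : V), v != 0 -> 0 < (v *m g x *m v^T) 0 0).

Variable g : V -> 'M[R]_n.

Definition dg (l i j : 'I_n) (x : V) : R := 'D_(ebasis l) (fun y => g y i j) x.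

(** Christoffel symbols of the Levi-Civita connection:
    Gam x u w = (Gamma^k_{ij}(x) u^i w^j)_k with
    Gamma^k_{ij} = 1/2 g^{kl} (d_i g_{jl} + d_j g_{il} - d_l g_{ij}). *)
Definition Gam (x u w : V) : V :=
  2^-1 *: ((\row_l \sum_i \sum_j (u 0 i * w 0 j *
              (dg i j l x + dg j i l x - dg l i j x))) *m invmx (g x)).

Definition covD (c : R -> V) (W : R -> V) (t : R) : V :=
  'D_1 W t + Gam (c t) ('D_1 c t) (W t).

Definition vel (c : R -> V) : R -> V := fun t => 'D_1 c t.

Definition rlength (c : R -> V) : R :=
  Rintegral lebesgue_measure `[0%R, 1%R]
    (fun s => Num.sqrt ((vel c s *m g (c s) *m (vel c s)^T) 0 0)).

Definition C1_curve (c : R -> V) (x y : V) : Prop :=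
  Ck setT 1 c /\ c 0 = x /\ c 1 = y.

Definition geodesic (c : R -> V) (x y : V) : Prop :=
  smooth_on setT c /\ c 0 = x /\ c 1 = y /\
  forall t, 0 <= t <= 1 -> covD c (vel c) t = 0.

Definition minimizing (c : R -> V) (x y : V) : Prop :=
  forall s, C1_curve s x y -> rlength c <= rlength s.

Definition unique_min_geodesics (M : set V) (gam : V -> V -> R -> V) : Prop :=
  forall x y, M x -> M y ->
    [/\ geodesic (gam x y) x y, minimizing (gam x y) x y &
        forall c, geodesic c x y -> minimizing c x y ->
          forall t, 0 <= t <= 1 -> c t = gam x y t].

Definition geod_convex (M : set V) (gam : V -> V -> R -> V) : Prop :=
  forall x y, M x -> M y -> forall t, 0 <= t <= 1 -> M (gam x y t).

Variable gam : V -> V -> R -> V.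

Definition parallel_transport (M : set V) (P : V -> V -> V -> V) : Prop :=
  forall x y (eta : V), M x -> M y ->
    exists W : R -> V, [/\ Ck setT 1 W, W 0 = eta, W 1 = P y x eta &
      forall t, 0 <= t <= 1 -> covD (gam x y) W t = 0].

Variable P : V -> V -> V -> V.

Definition rlog (x y : V) : V := vel (gam x y) 0.

Definition diso (x y : V) : R :=
  Rintegral lebesgue_measure `[0%R, 1%R] (fun s => norm2 (vel (gam x y) s)).

Definition log_iso (x y : V) : V := (diso x y / norm2 (rlog x y)) *: rlog x y.

Definition P_iso (y x eta : V) : V :=
  (norm2 (rlog x y) / norm2 (rlog y x)) *: P y x eta.

Definition nabla_iso (xi : V -> V) (x y : V) (t : R) : V :=
  let c := gam x y in
  (norm2 (vel c t))^-1 *: covD c (fun s => norm2 (vel c s) *: xi (c s)) t.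

Variable M : set V.
Variable xi : V -> V.

Definition iso_monotone : Prop :=
  forall x y, M x -> M y -> x != y ->
    0 <= dot2 (xi y - P_iso y x (xi x)) (P_iso y x (log_iso x y)).

Definition strongly_iso_monotone (a : R) : Prop :=
  forall x y, M x -> M y -> x != y ->
    a * diso x y ^+ 2 <= dot2 (xi y - P_iso y x (xi x)) (P_iso y x (log_iso x y)).

Definition iso_Lipschitz (L : R) : Prop :=
  forall x y, M x -> M y -> x != y ->
    norm2 (xi y - P_iso y x (xi x)) <= L * diso x y.

Definition loc_iso_monotone : Prop :=
  forall x y, M x -> M y -> x != y -> forall t, 0 <= t <= 1 ->
    0 <= dot2 (P y (gam x y t) (nabla_iso xi x y t)) (P y x (rlog x y)).

Definition loc_strongly_iso_monotone (a : R) : Prop :=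
  forall x y, M x -> M y -> x != y -> forall t, 0 <= t <= 1 ->
    a * norm2 (rlog y x) ^+ 2 <=
      dot2 (P y (gam x y t) (nabla_iso xi x y t)) (P y x (rlog x y)).

Definition loc_iso_Lipschitz (L : R) : Prop :=
  forall x y, M x -> M y -> x != y -> forall t, 0 <= t <= 1 ->
    norm2 (P y (gam x y t) (nabla_iso xi x y t)) <= L * norm2 (rlog y x).

End Iso.

(* Main.v *)
(** Fix x <> y, the geodesic c from x to y and a vector u. The adjoint of
    parallel transport along c, paired with u, is a parallel field Y: by metric
    compatibility, dot2 (P y (c t) eta) u = <eta, Y t> at c t. Hence
    f t := <|c' t| xi (c t), Y t> has derivative
    |c' t| * dot2 (P y (c t) (nabla_iso xi t)) u, and integrating a local lower
    bound k on the last factor gives k * diso x y <= f 1 - f 0, where f 1 - f 0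
    equals |log_y x| * dot2 (xi y - P_iso xi x) u. Taking u = P log_x y yields (i)
    and (ii), and taking u opposite to xi y - P_iso xi x yields (iii) by
    Cauchy-Schwarz. Since P y (c t) is transport along the geodesic chosen from
    c t to y, one needs that restrictions and reversals of minimizers are
    minimizers, and then uniqueness. *)
Require Import Defs.
From HB Require Import structures.
From mathcomp Require Import all_boot all_order all_algebra.
From mathcomp Require Import all_classical all_reals all_analysis.
From mathcomp Require Import ring lra.
Import Order.TTheory GRing.Theory Num.Theory.
Import numFieldNormedType.Exports.
Local Open Scope classical_set_scope.
Local Open Scope ring_scope.

(** * Derivatives, gluing and antiderivatives for functions of one real variable *)

Section OneVariableCalculus.
Context {R : realType}.

Lemma is_derive_comp_differentiable {U W : normedModType R} (c : R -> U)
    (f : U -> W) (t : R) (c' : U) :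
  is_derive t 1 c c' -> differentiable f (c t) ->
  is_derive t 1 (f \o c) ('D_c' f (c t)).
Proof.
move=> [dc <-] df.
have dc1 : differentiable c t by apply/derivable1_diffP.
have dfc : differentiable (f \o c) t by exact: differentiable_comp.
apply: DeriveDef; first exact/derivable1_diffP.
by rewrite deriveE// diff_comp//= -deriveE// -deriveE.
Qed.

Lemma is_derive_comp1 {U : normedModType R} (c : R -> U) (p : R -> R)
    (t p' : R) (c' : U) :
  is_derive t 1 p p' -> is_derive (p t) 1 c c' ->
  is_derive t 1 (c \o p) (p' *: c').
Proof.
move=> dp [dc <-].
have dc1 : differentiable c (p t) by apply/derivable1_diffP.
have H := @is_derive_comp_differentiable _ _ p c t p' dp dc1.
apply: is_derive_eq H _.
rewrite deriveE// deriveE// -linearZ/=.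
by congr ('d c _ _); rewrite -[RHS]/(p' * 1) mulr1.
Qed.

Lemma is_derive_affine (a b t v : R) :
  is_derive t v (fun u => a + u * b) (v * b).
Proof.
have -> : (fun u : R => a + u * b) = cst a + b *: id.
  by apply/funext => u; rewrite mulrC.
apply: is_derive_eq (is_deriveD (is_derive_cst a t v) (is_deriveZ b (is_derive_id t v))) _.
by rewrite add0r -[b *: v]/(b * v) mulrC.
Qed.

(** Each difference quotient of the glued function at [a] is that of [f] or that of [g], and both
    tend to [l]. *)
Lemma is_derive_glue {U : normedModType R} (f g : R -> U) (a : R) (l : U) :
  f a = g a -> is_derive a 1 f l -> is_derive a 1 g l ->
  is_derive a 1 (fun u => if u <= a then f u else g u) l.
Proof.
move=> fga [df dfl] [dg dgl].
set k := fun u => _.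
have cf : h^-1 *: ((f \o shift a) (h *: 1) - f a) @[h --> 0^'] --> l.
  by rewrite -dfl; exact: df.
have cg : h^-1 *: ((g \o shift a) (h *: 1) - g a) @[h --> 0^'] --> l.
  by rewrite -dgl; exact: dg.
have ck : h^-1 *: ((k \o shift a) (h *: 1) - k a) @[h --> 0^'] --> l.
  move=> A Al; have fA := cf A Al; have gA := cg A Al.
  move: fA gA; rewrite /nbhs/=; apply: filterS2 => h /= fh gh.
  by rewrite /k lexx; case: ifP => // _; rewrite fga.
apply: DeriveDef; first by apply/cvg_ex; exists l.
exact: cvg_lim ck.
Qed.

(** Away from [a] the glued function is locally one of its branches, so each branch only has to be
    differentiable on its own closed side. *)
Lemma is_derive_glueP {U : normedModType R} (f g f' g' : R -> U) (a u : R) :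
  f a = g a -> f' a = g' a ->
  (u <= a -> is_derive u 1 f (f' u)) -> (a <= u -> is_derive u 1 g (g' u)) ->
  is_derive u 1 (fun v => if v <= a then f v else g v)
    (if u <= a then f' u else g' u).
Proof.
move=> fga fga' df dg; have [ua|au|uaE] := ltgtP u a.
- apply: (@near_eq_is_derive _ _ _ f) (df (ltW ua)).
  by near=> v; rewrite ifT//; apply: ltW; near: v; exact: lt_nbhsl.
- apply: (@near_eq_is_derive _ _ _ g) (dg (ltW au)).
  near=> v; rewrite ifF//; apply/negbTE; rewrite -ltNge; near: v.
  exact: lt_nbhsr.
- rewrite uaE; apply: is_derive_glue => //; first by rewrite -uaE; apply: df; rewrite uaE.
  by rewrite fga' -uaE; apply: dg; rewrite uaE.
Unshelve. all: by end_near. Qed.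

Lemma continuous_glue {U : topologicalType} (f g : R -> U) (a : R) :
  f a = g a -> continuous f -> continuous g ->
  continuous (fun u => if u <= a then f u else g u).
Proof.
move=> fga cf cg x.
have [xa|ax|->] := ltgtP x a.
- rewrite /continuous_at leNgt (lt_gtF xa)/=; apply: cvg_trans (cf x).
  apply: near_eq_cvg; near=> u; rewrite ifT//; apply: ltW; near: u.
  exact: lt_nbhsl.
- rewrite /continuous_at leNgt ax/=; apply: cvg_trans (cg x).
  apply: near_eq_cvg; near=> u; rewrite ifF//; apply/negbTE; rewrite -ltNge; near: u.
  exact: lt_nbhsr.
- rewrite /continuous_at lexx => A Aa.
  have fA : \forall u \near a, A (f u) := cf a A Aa.
  have gA : \forall u \near a, A (g u) by apply: (cg a A); rewrite -fga.
  suff : \forall u \near a, A (if u <= a then f u else g u) by [].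
  by near=> u; case: (u <= a); near: u.
Unshelve. all: by end_near. Qed.

Lemma continuous_within_segment (f : R -> R) (a b : R) :
  (forall t : R, a <= t <= b -> {for t, continuous f}) ->
  {within `[a, b], continuous f}.
Proof.
by move=> cf; apply: continuous_in_subspaceT => t /[!inE]/= /[!in_itv]/= /cf.
Qed.

Lemma is_derive_continuous {U : normedModType R} (f : R -> U) (t : R) (l : U) :
  is_derive t 1 f l -> {for t, continuous f}.
Proof.
by case=> df _; exact/differentiable_continuous/derivable1_diffP.
Qed.

Lemma constant_of_derive0 (f : R -> R) (a b : R) : a <= b ->
  (forall t : R, a < t < b -> is_derive t 1 f 0) ->
  (forall t : R, a <= t <= b -> {for t, continuous f}) -> f b = f a.
Proof.
move=> ab df cf; apply/subr0_eq.
have df0 x : x \in `]a, b[ -> is_derive x 1 f 0 by rewrite in_itv; exact: df.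
have [c _ ->] := MVT_segment ab df0 (continuous_within_segment _ _ _ cf).
by rewrite mul0r.
Qed.

(** Lengths and iso-distances are computed below by exhibiting an antiderivative, which replaces
    changes of variables in integrals. *)
Lemma Rintegral_antiderivative (h F : R -> R) : continuous h ->
  (forall t : R, 0 <= t <= 1 -> is_derive t 1 F (h t)) ->
  Rintegral lebesgue_measure `[0, 1] h = F 1 - F 0.
Proof.
move=> ch dF.
have cF (t : R) : 0 <= t <= 1 -> {for t, continuous F}.
  by move=> /dF; exact: is_derive_continuous.
rewrite /Rintegral (@continuous_FTC2 R h F 0 1)//.
- exact: continuous_subspaceT.
- have /continuous_within_itvP [//|_ l0 l1] := continuous_within_segment _ _ _ cF.
  split=> // x; rewrite in_itv/= => /andP[x0 x1].
  by have [] := dF x; rewrite ?ltW.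
- move=> x; rewrite in_itv/= => /andP[x0 x1]; rewrite derive1E.
  by have [] := dF x; rewrite ?ltW.
Qed.

Lemma continuous_antiderivative (h : R -> R) : continuous h ->
  exists F : R -> R, forall t : R, 0 <= t <= 1 -> is_derive t 1 F (h t).
Proof.
(* Integrating from -1, with integrability up to 2, makes 0 and 1 interior points, so the
   derivatives there are two-sided. *)
move=> ch; pose F t := (\int[lebesgue_measure]_(x in `[(-1)%R, t]) h x).
exists F => t /andP[t0 t1].
have ih : lebesgue_measure.-integrable `[(-1)%R, 2%R] (EFin \o h).
  apply: continuous_compact_integrable; first exact: segment_compact.
  exact: continuous_subspaceT.
have [||dF F'] := @continuous_FTC1_closed R h (-1) t 2 _ ih _ (ch t); [lra|lra|].
by apply: (DeriveDef dF); rewrite -derive1E F'.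
Qed.

(** The derivative in direction [v] is that of [f] in direction [v * b] at the same affine argument,
    so induction on [k] applies to it. *)
Lemma Ck_affine {U : normedModType R} (k : nat) (f : R -> U) (a b : R) :
  Ck setT k f -> Ck setT k (fun u : R => f (a + u * b)).
Proof.
have daff := is_derive_affine a b.
have caff : continuous (fun u : R => a + u * b).
  by move=> t; exact: is_derive_continuous (daff t 1).
elim: k f => [|k IH] f /=.
  by move=> cf x _; apply: continuous_comp; [exact: caff|exact: cf].
move=> [df Df].
have daffx x : differentiable (fun u : R => a + u * b) x.
  by apply/derivable1_diffP; have [] := daff x 1.
split=> [x _|v].
  by apply: (@differentiable_comp _ _ _ _ (fun u : R => a + u * b) f); last exact: df.
suff -> : (fun x => 'D_v (fun u : R => f (a + u * b)) x) =
  (fun x => 'D_(v * b) f (a + x * b)) by exact: (IH ('D_(v * b) f)).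
apply/funext => x.
rewrite deriveE; last first.
  by apply: (@differentiable_comp _ _ _ _ (fun u : R => a + u * b) f); last exact: df.
rewrite (@diff_comp _ _ _ _ (fun u : R => a + u * b) f)//=; last exact: df.
rewrite -deriveE; last exact: df.
have dE : 'd (fun u : R => a + u * b) x v = v * b.
  by rewrite -deriveE//; have [_ ->] := daff x v.
by rewrite dE.
Qed.

End OneVariableCalculus.

(** * Derivatives and regularity of curves *)

Section Curves.
Context {R : realType} {n : nat}.
Notation V := 'rV[R]_n.

Lemma is_derive_rowP (W : R -> V) (t : R) (w : V) :
  is_derive t 1 W w <-> forall i, is_derive t 1 (fun s => W s 0 i) (w 0 i).
Proof.
split=> [[dW <-] i|dW].
  apply: DeriveDef; first by move/derivable_mxP: dW; apply.
  by rewrite derive_mx// mxE.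
have dW1 : derivable W t 1.
  by apply/derivable_mxP => k i; rewrite ord1; have [] := dW i.
apply: DeriveDef => //; apply/rowP => i; rewrite derive_mx// mxE.
by have [] := dW i.
Qed.

Lemma Ck1_is_derive (c : R -> V) (t : R) :
  Ck setT 1 c -> is_derive t 1 c (vel c t).
Proof. by move=> [dc _]; apply/derivableP/derivable1_diffP/dc. Qed.

Lemma Ck1_vel_continuous (c : R -> V) : Ck setT 1 c -> continuous (vel c).
Proof. by move=> [_ /(_ 1) /= cc] t; exact: cc. Qed.

Lemma Ck1_continuous (c : R -> V) : Ck setT 1 c -> continuous c.
Proof. by move=> [dc _] t; exact: differentiable_continuous (dc t I). Qed.

Lemma Ck1_of_derive (c c' : R -> V) :
  (forall t : R, is_derive t 1 c (c' t)) -> continuous c' -> Ck setT 1 c.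
Proof.
move=> dc cc'.
have dfc t : differentiable c t by apply/derivable1_diffP; have [] := dc t.
split=> [t _|v t _ /=]; first exact: dfc.
have -> : (fun x : R => 'D_v c x) = (fun x => v *: c' x).
  apply/funext => x; rewrite deriveE//.
  rewrite -[v in LHS]mulr1 -[v * 1]/(v *: (1 : R)) linearZ/= -deriveE//.
  by have [_ ->] := dc x.
by apply: cvgZ; [exact: cvg_cst|exact: cc'].
Qed.

Lemma smooth_on_Ck1 (c : R -> V) : smooth_on setT c -> Ck setT 1 c.
Proof. by move=> /(_ 1%N). Qed.

Lemma smooth_on_vel (c : R -> V) : smooth_on setT c -> Ck setT 1 (vel c).
Proof. by move=> /(_ 2%N) [_ /(_ 1)]. Qed.

End Curves.

(** * The Riemannian inner product and metric compatibility of the connection *)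

Section Metric.
Context {R : realType} {n : nat}.
Notation V := 'rV[R]_n.

Lemma is_derive_mul (f h : R -> R) (t f' h' : R) :
  is_derive t 1 f f' -> is_derive t 1 h h' ->
  is_derive t 1 (fun s => f s * h s) (f' * h t + f t * h').
Proof.
move=> df dh; have -> : (fun s => f s * h s) = f * h by [].
apply: is_derive_eq.
by rewrite -[f t *: h']/(f t * h') -[h t *: f']/(h t * f') addrC [f' * _]mulrC.
Qed.

Lemma is_derive_bigsum (m : nat) (h : 'I_m -> R -> R) (t : R) (h' : 'I_m -> R) :
  (forall i, is_derive t 1 (h i) (h' i)) ->
  is_derive t 1 (fun s => \sum_i h i s) (\sum_i h' i).
Proof.
move=> dh; rewrite (_ : (fun s => _) = \sum_i h i); first exact: is_derive_sum.
by apply/funext => s; rewrite fct_sumE.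
Qed.

Lemma derive_coordinates (f : V -> R) (x v : V) : differentiable f x ->
  'D_v f x = \sum_l v 0 l * 'D_(ebasis l) f x.
Proof.
move=> df; rewrite deriveE// [in LHS](row_sum_delta v) linear_sum/=.
by apply: eq_bigr => l _; rewrite linearZ/= -deriveE.
Qed.

Variable g : V -> 'M[R]_n.

(** The metric stays a parameter, so that taking it constantly [1%:M] gives [dot2] and the same
    lemmas serve both inner products. *)
Definition mdot (x u v : V) : R := (u *m g x *m v^T) 0 0.

Lemma mdotE (x u v : V) :
  mdot x u v = \sum_i \sum_j u 0 i * g x i j * v 0 j.
Proof.
rewrite /mdot mxE exchange_big/=; apply: eq_bigr => j _.
by rewrite !mxE mulr_suml.
Qed.

Lemma mdotDl (x u v w : V) : mdot x (u + v) w = mdot x u w + mdot x v w.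
Proof. by rewrite /mdot !mulmxDl mxE. Qed.

Lemma mdotDr (x u v w : V) : mdot x u (v + w) = mdot x u v + mdot x u w.
Proof. by rewrite /mdot linearD mulmxDr mxE. Qed.

Lemma mdotZl (k : R) (x u v : V) : mdot x (k *: u) v = k * mdot x u v.
Proof. by rewrite /mdot -!scalemxAl mxE. Qed.

Lemma mdotZr (k : R) (x u v : V) : mdot x u (k *: v) = k * mdot x u v.
Proof. by rewrite /mdot linearZ/= -scalemxAr mxE. Qed.

Lemma mdot0l (x v : V) : mdot x 0 v = 0.
Proof. by rewrite /mdot !mul0mx mxE. Qed.

Lemma mdot0r (x v : V) : mdot x v 0 = 0.
Proof. by rewrite /mdot linear0 mulmx0 mxE. Qed.

Hypothesis gP : riemannian_metric g.

Lemma metric_differentiable (i j : 'I_n) (x : V) :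
  differentiable (fun y => g y i j) x.
Proof. by have [/(_ i j 1%N) [/(_ x I)]] := gP. Qed.

Lemma metric_sym (x : V) (i j : 'I_n) : g x i j = g x j i.
Proof. by have [_ [/(_ x) gT _]] := gP; rewrite -[in LHS]gT mxE. Qed.

Lemma mdotC (x u v : V) : mdot x u v = mdot x v u.
Proof.
rewrite !mdotE exchange_big/=; apply: eq_bigr => j _; apply: eq_bigr => i _.
by rewrite metric_sym; ring.
Qed.

Lemma mdot_gt0 (x v : V) : v != 0 -> 0 < mdot x v v.
Proof. by have [_ [_ +]] := gP; exact. Qed.

Lemma mdot_eq0 (x v : V) : (mdot x v v == 0) = (v == 0).
Proof.
apply/idP/eqP => [|->]; last by rewrite mdot0l.
by apply: contraTeq => /(mdot_gt0 x) /gt_eqF ->.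
Qed.

Lemma metric_unitmx (x : V) : g x \in unitmx.
Proof.
rewrite -row_free_unit; apply: inj_row_free => v vg0; apply/eqP.
by rewrite -(mdot_eq0 x) /mdot vg0 mul0mx mxE.
Qed.

Lemma dg_sym (l i j : 'I_n) (x : V) : dg g l i j x = dg g l j i x.
Proof.
have -> : dg g l i j x = 'D_(ebasis l) (fun y => g y i j) x by [].
have -> // : (fun y => g y i j) = (fun y => g y j i).
by apply/funext => y; exact: metric_sym.
Qed.

(** Pairing with the metric cancels [invmx (g x)] and leaves the Christoffel symbols of the first
    kind. *)
Lemma mdot_Gam (x u a b : V) : mdot x (Gam g x u a) b =
  2^-1 * \sum_l \sum_i \sum_j u 0 i * a 0 j * b 0 l *
    (dg g i j l x + dg g j i l x - dg g l i j x).
Proof.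
rewrite /mdot /Gam -!scalemxAl mxE mulmxKV ?metric_unitmx// mxE.
congr (_ * _); apply: eq_bigr => l _; rewrite !mxE mulr_suml.
apply: eq_bigr => i _; rewrite mulr_suml; apply: eq_bigr => j _; ring.
Qed.

(* The antisymmetric parts of the two Christoffel terms cancel. *)
Lemma mdot_Gam_compat (x u a b : V) :
  mdot x (Gam g x u a) b + mdot x a (Gam g x u b) =
  \sum_i \sum_j a 0 i * (\sum_l u 0 l * dg g l i j x) * b 0 j.
Proof.
rewrite (mdotC x a) !mdot_Gam.
(* Exchanging [j] and [l], and using the symmetry of [g], flips the signs of the last two terms
   relative to the first sum. *)
have -> : \sum_l \sum_i \sum_j u 0 i * b 0 j * a 0 l *
    (dg g i j l x + dg g j i l x - dg g l i j x) =
  \sum_l \sum_i \sum_j u 0 i * a 0 j * b 0 l *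
    (dg g i j l x + dg g l i j x - dg g j i l x).
  rewrite exchange_big [RHS]exchange_big/=; apply: eq_bigr => i _.
  rewrite exchange_big; apply: eq_bigr => l _; apply: eq_bigr => j _.
  by rewrite (dg_sym i l j); ring.
rewrite -mulrDr -big_split/= mulr_sumr.
have -> : \sum_i \sum_j a 0 i * (\sum_l u 0 l * dg g l i j x) * b 0 j =
  \sum_l \sum_i \sum_j u 0 i * a 0 j * b 0 l * dg g i j l x.
  rewrite exchange_big/=; apply: eq_bigr => l _.
  rewrite exchange_big/=; apply: eq_bigr => j _.
  by rewrite mulr_sumr mulr_suml; apply: eq_bigr => i _; ring.
apply: eq_bigr => l _; rewrite -big_split/= mulr_sumr.
apply: eq_bigr => i _; rewrite -big_split/= mulr_sumr.
by apply: eq_bigr => j _; field.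
Qed.

(** The product rule in coordinates produces the derivative of [g] along [c], which
    [mdot_Gam_compat] identifies with the two Christoffel terms. *)
Lemma is_derive_mdot (c A B : R -> V) (t : R) :
  derivable c t 1 -> derivable A t 1 -> derivable B t 1 ->
  is_derive t 1 (fun s => mdot (c s) (A s) (B s))
    (mdot (c t) (covD g c A t) (B t) + mdot (c t) (A t) (covD g c B t)).
Proof.
move=> /derivableP dc /derivableP/is_derive_rowP dA /derivableP/is_derive_rowP dB.
have dG i j : is_derive t 1 (fun s => g (c s) i j)
    (\sum_l vel c t 0 l * dg g l i j (c t)).
  rewrite -derive_coordinates; last exact: metric_differentiable.
  have := is_derive_comp_differentiable c _ t _ dc (metric_differentiable i j (c t)).
  exact.
rewrite (_ : (fun s => _) =
  fun s => \sum_i \sum_j A s 0 i * g (c s) i j * B s 0 j); last first.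
  by apply/funext => s; rewrite mdotE.
have D : is_derive t 1 (fun s => \sum_i \sum_j A s 0 i * g (c s) i j * B s 0 j)
  (\sum_i \sum_j ((vel A t 0 i * g (c t) i j +
      A t 0 i * (\sum_l vel c t 0 l * dg g l i j (c t))) * B t 0 j +
    A t 0 i * g (c t) i j * vel B t 0 j)).
  apply: is_derive_bigsum => i; apply: is_derive_bigsum => j.
  exact: (is_derive_mul _ _ _ _ _ (is_derive_mul _ _ _ _ _ (dA i) (dG i j)) (dB j)).
apply: is_derive_eq D _.
rewrite /covD mdotDl mdotDr addrACA mdot_Gam_compat !mdotE -!big_split/=.
apply: eq_bigr => i _; rewrite -!big_split/=; apply: eq_bigr => j _.
by rewrite /vel; ring.
Qed.

End Metric.

(** * Length under reparametrization; reversals and restrictions of minimizers *)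

Section Length.
Context {R : realType} {n : nat}.
Notation V := 'rV[R]_n.
Variable g : V -> 'M[R]_n.

Definition speed (c : R -> V) (t : R) : R :=
  Num.sqrt (mdot g (c t) (vel c t) (vel c t)).

(** Only values and velocities at single points enter, so it applies to each branch of a
    concatenated curve. *)
Lemma speed_scale (c d : R -> V) (t u k : R) :
  d u = c t -> vel d u = k *: vel c t -> speed d u = `|k| * speed c t.
Proof.
move=> dc vdc; rewrite /speed dc vdc mdotZl mdotZr mulrA -expr2 sqrtrM ?sqr_ge0//.
by rewrite sqrtr_sqr.
Qed.

Lemma vel_comp (c : R -> V) (p : R -> R) (p' t : R) : Ck setT 1 c ->
  is_derive t 1 p p' -> vel (c \o p) t = p' *: vel c (p t).
Proof.
move=> cC dp.
by have [_] := is_derive_comp1 c p t p' _ dp (Ck1_is_derive c (p t) cC).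
Qed.

Lemma continuous_mdot (c A B : R -> V) (t : R) : riemannian_metric g ->
  {for t, continuous c} -> {for t, continuous A} -> {for t, continuous B} ->
  {for t, continuous (fun s => mdot g (c s) (A s) (B s))}.
Proof.
move=> gP cc cA cB.
have coord (W : R -> V) i : {for t, continuous W} ->
    (fun s => W s 0 i) @ t --> W t 0 i.
  by move=> cW; apply: (@cvg_comp _ _ _ W (fun w : V => w 0 i) _ (nbhs (W t)));
    [exact: cW|exact: coord_continuous].
have -> : (fun s => mdot g (c s) (A s) (B s)) =
    fun s => \sum_i \sum_j A s 0 i * g (c s) i j * B s 0 j.
  by apply/funext => s; rewrite mdotE.
apply: cvg_big => [|i _]; first exact: add_continuous.
apply: cvg_big => [|j _]; first exact: add_continuous.
apply: cvgM; last exact: coord.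
apply: cvgM; first exact: coord.
apply: (@cvg_comp _ _ _ c (fun x : V => g x i j) _ (nbhs (c t))); first exact: cc.
exact: differentiable_continuous (metric_differentiable g gP i j (c t)).
Qed.

Hypothesis gP : riemannian_metric g.

Lemma speed_continuous (c : R -> V) : Ck setT 1 c -> continuous (speed c).
Proof.
move=> cC t; apply: continuous_comp; last exact: sqrt_continuous.
have cv := Ck1_vel_continuous c cC t.
exact: (continuous_mdot c (vel c) (vel c) t gP (Ck1_continuous c cC t) cv cv).
Qed.

Lemma rlength_antiderivative (c : R -> V) (F : R -> R) : Ck setT 1 c ->
  (forall t : R, 0 <= t <= 1 -> is_derive t 1 F (speed c t)) ->
  rlength g c = F 1 - F 0.
Proof.
by move=> cC; apply: Rintegral_antiderivative; exact: speed_continuous.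
Qed.

Lemma Ck1_affine (c : R -> V) (a b : R) :
  Ck setT 1 c -> Ck setT 1 (fun u : R => c (a + u * b)).
Proof. exact: Ck_affine. Qed.

Lemma speed_affine (c : R -> V) (a b t : R) : Ck setT 1 c ->
  speed (fun u => c (a + u * b)) t = `|b| * speed c (a + t * b).
Proof.
move=> cC; apply: speed_scale => //.
apply: (vel_comp c (fun u => a + u * b)) => //.
by apply: is_derive_eq (is_derive_affine a b t 1) _; rewrite mul1r.
Qed.

Lemma is_derive_comp_affine {U : normedModType R} (f : R -> U) (a b t : R) (l : U) :
  is_derive (a + t * b) 1 f l -> is_derive t 1 (fun u => f (a + u * b)) (b *: l).
Proof.
move=> df; apply: (is_derive_comp1 f (fun u => a + u * b)) => //.
by apply: is_derive_eq (is_derive_affine a b t 1) _; rewrite mul1r.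
Qed.

Lemma rlength_reverse (c : R -> V) : Ck setT 1 c ->
  rlength g (fun u => c (1 + u * -1)) = rlength g c.
Proof.
move=> cC.
have [F dF] := continuous_antiderivative _ (speed_continuous c cC).
(* This is [- F (1 - u)], written in the affine form that the derivative lemmas expect. *)
pose G u := 0 + F (1 + u * -1) * -1.
have rC := Ck1_affine c 1 (-1) cC.
have dG (t : R) : 0 <= t <= 1 ->
    is_derive t 1 G (speed (fun u => c (1 + u * -1)) t).
  move=> t01; rewrite speed_affine// normrN normr1.
  have dF1 := is_derive_comp_affine F 1 (-1) t _ (dF (1 + t * -1) ltac:(lra)).
  have D := is_derive_comp1 _ _ _ _ _ dF1 (is_derive_affine 0 (-1) (F (1 + t * -1)) 1).
  apply: is_derive_eq D _.
  by rewrite -[-1 *: _]/(-1 * _) -[_ *: (1 * -1)]/(_ * (1 * -1)); ring.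
rewrite (rlength_antiderivative c F cC dF) (rlength_antiderivative _ G rC dG).
by rewrite /G mul1r mul0r subrr addr0; ring.
Qed.

(** Reversal preserves length and turns every competitor from [y] to [x] into one from [x] to
    [y]. *)
Lemma minimizing_reverse (c : R -> V) (x y : V) : Ck setT 1 c ->
  minimizing g c x y -> minimizing g (fun u => c (1 + u * -1)) y x.
Proof.
move=> cC cmin s [sC [s0 s1]].
rewrite (rlength_reverse c cC) -(rlength_reverse s sC); apply: cmin.
by split; [exact: Ck1_affine|rewrite mul0r addr0 mul1r subrr].
Qed.

(** Derivative of the quadratic reparametrizations used to round off a corner in the next lemma. *)
Lemma is_derive_sqr_affine (k m a b t : R) :
  is_derive t 1 (fun u => k + (a + u * b) ^+ 2 * m) (2 * (a + t * b) * b * m).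
Proof.
have dsq := is_derive_comp1 _ _ _ _ _
  (is_derive_mul id id (a + t * b) 1 1 (is_derive_id _ _) (is_derive_id _ _))
  (is_derive_affine k m ((a + t * b) * (a + t * b)) 1).
apply: is_derive_eq (is_derive_comp_affine _ a b t _ dsq) _.
by rewrite /= /GRing.scale/=; ring.
Qed.

(* Both pieces are reparametrized so as to reach the corner with zero velocity:
   the concatenated competitor is then C^1. *)
Lemma minimizing_restrict (c : R -> V) (x y : V) (t : R) : Ck setT 1 c ->
  c 0 = x -> c 1 = y -> 0 <= t <= 1 -> minimizing g c x y ->
  minimizing g (fun u => c (t + u * (1 - t))) (c t) y.
Proof.
move=> cC c0 c1 t01 cmin s [sC [s0 s1]].
have [F dF] := continuous_antiderivative _ (speed_continuous c cC).
have [S dS] := continuous_antiderivative _ (speed_continuous s sC).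
have -> : rlength g (fun u => c (t + u * (1 - t))) = F 1 - F t.
  pose G u := F (t + u * (1 - t)).
  have dG (u : R) : 0 <= u <= 1 ->
      is_derive u 1 G (speed (fun u => c (t + u * (1 - t))) u).
    move=> u01; rewrite speed_affine// ger0_norm; last lra.
    by apply: is_derive_comp_affine; apply: dF; nra.
  rewrite (rlength_antiderivative _ G (Ck1_affine c t (1 - t) cC) dG).
  by rewrite /G mul1r mul0r addr0 [t + _]addrC subrK.
rewrite (rlength_antiderivative s S sC dS).
(* [p1] climbs from 0 to [t] on the first half of the unit interval, [p2] from 0 to 1 on the second
   half, and both have derivative 0 at one half. *)
pose p1 (u : R) : R := t + (1 + u * -2) ^+ 2 * - t.
pose p2 (u : R) : R := 0 + (-1 + u * 2) ^+ 2 * 1.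
pose p1' (u : R) : R := 4 * t + u * (-8 * t).
pose p2' (u : R) : R := -4 + u * 8.
have dp1 (u : R) : is_derive u 1 p1 (p1' u).
  by apply: is_derive_eq (is_derive_sqr_affine _ _ _ _ u) _; rewrite /p1'; ring.
have dp2 (u : R) : is_derive u 1 p2 (p2' u).
  by apply: is_derive_eq (is_derive_sqr_affine _ _ _ _ u) _; rewrite /p2'; ring.
have p1h : p1 2^-1 = t by rewrite /p1; field.
have p2h : p2 2^-1 = 0 by rewrite /p2; field.
have p1'h : p1' 2^-1 = 0 by rewrite /p1'; field.
have p2'h : p2' 2^-1 = 0 by rewrite /p2'; field.
pose sg (u : R) := if u <= 2^-1 then c (p1 u) else s (p2 u).
pose sg' (u : R) := if u <= 2^-1 then p1' u *: vel c (p1 u) else p2' u *: vel s (p2 u).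
(* An antiderivative of the speed of [sg]; the constant [F t - S 0] makes the two branches meet at
   one half. *)
pose H (u : R) := if u <= 2^-1 then F (p1 u) else F t - S 0 + S (p2 u).
have dsg (u : R) : is_derive u 1 sg (sg' u).
  apply: (is_derive_glueP (c \o p1) (s \o p2) (fun u => p1' u *: vel c (p1 u))
    (fun u => p2' u *: vel s (p2 u))) => /=.
  - by rewrite p1h p2h s0.
  - by rewrite p1'h p2'h !scale0r.
  - by move=> _; apply: is_derive_comp1 => //; exact: Ck1_is_derive.
  - by move=> _; apply: is_derive_comp1 => //; exact: Ck1_is_derive.
have sgC : Ck setT 1 sg.
  apply: Ck1_of_derive dsg _.
  have caff (a b : R) : continuous (fun u : R => a + u * b).
    by move=> u; exact: is_derive_continuous (is_derive_affine a b u 1).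
  have cq (p p' : R -> R) (d : R -> V) : continuous p' -> Ck setT 1 d ->
      (forall u : R, is_derive u 1 p (p' u)) -> continuous (fun u => p' u *: vel d (p u)).
    move=> cp' dC dp u; apply: cvgZ; first exact: cp'.
    apply: (@continuous_comp _ _ _ p (vel d)); first exact: is_derive_continuous (dp u).
    exact: Ck1_vel_continuous.
  apply: continuous_glue.
  - by rewrite p1'h p2'h !scale0r.
  - by apply: (cq p1 p1' c) => //; exact: caff.
  - by apply: (cq p2 p2' s) => //; exact: caff.
have dH (u : R) : 0 <= u <= 1 -> is_derive u 1 H (speed sg u).
  move=> u01.
  have -> : speed sg u = if u <= 2^-1 then p1' u * speed c (p1 u)
      else p2' u * speed s (p2 u).
    have [_ vsg] := dsg u.
    case: ifPn => uh.
      rewrite (@speed_scale c sg (p1 u) u (p1' u)).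
      - by rewrite ger0_norm// /p1'; nra.
      - by rewrite /sg uh.
      - by rewrite /vel vsg /sg' uh.
    rewrite (@speed_scale s sg (p2 u) u (p2' u)).
    - by rewrite ger0_norm// /p2'; rewrite -ltNge in uh; lra.
    - by rewrite /sg (negbTE uh).
    - by rewrite /vel vsg /sg' (negbTE uh).
  apply: (is_derive_glueP (F \o p1) (fun u => F t - S 0 + S (p2 u))
    (fun u => p1' u * speed c (p1 u)) (fun u => p2' u * speed s (p2 u))) => /=.
  - by rewrite p1h p2h; ring.
  - by rewrite p1'h p2'h; exact: etrans (mul0r _) (esym (mul0r _)).
  - move=> uh; apply: (is_derive_comp1 F p1) => //; apply: dF.
    have w0 : 0 <= (1 + u * -2) ^+ 2 := sqr_ge0 _.
    have w1 : (1 + u * -2) ^+ 2 <= 1 by nra.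
    by rewrite /p1; apply/andP; split; nra.
  - move=> uh; rewrite -[_ * _]add0r; apply: is_deriveD.
    apply: (is_derive_comp1 S p2) => //; apply: dS.
    have w0 : 0 <= (-1 + u * 2) ^+ 2 := sqr_ge0 _.
    have w1 : (-1 + u * 2) ^+ 2 <= 1 by nra.
    by rewrite /p2; apply/andP; split; nra.
have := cmin sg.
rewrite (rlength_antiderivative c F cC dF) (rlength_antiderivative sg H sgC dH).
have sg0 : sg 0 = x.
  by rewrite /sg ifT ?invr_ge0// -c0; congr c; rewrite /p1; ring.
have sg1 : sg 1 = y.
  rewrite /sg ifF; last by apply/negbTE; rewrite -ltNge; lra.
  by rewrite -s1; congr s; rewrite /p2; ring.
have -> : H 0 = F 0.
  by rewrite /H ifT ?invr_ge0//; congr F; rewrite /p1; ring.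
have -> : H 1 = F t - S 0 + S 1.
  rewrite /H ifF; last by apply/negbTE; rewrite -ltNge; lra.
  by congr (_ + S _); rewrite /p2; ring.
(* Minimality reads [F 1 - F 0 <= F t - S 0 + S 1 - F 0]; the common initial piece [F t - F 0] drops
   out. *)
move=> /(_ (conj sgC (conj sg0 sg1))); lra.
Qed.

End Length.

(** * Covariant derivatives under affine reparametrization; parallel fields and geodesics *)

Section Geodesics.
Context {R : realType} {n : nat}.
Notation V := 'rV[R]_n.
Variable g : V -> 'M[R]_n.

Lemma GamZl (x u w : V) (k : R) : Gam g x (k *: u) w = k *: Gam g x u w.
Proof.
rewrite /Gam scalerA mulrC -scalerA; congr (_ *: _).
rewrite scalemxAl; congr (_ *m _); apply/rowP => l; rewrite !mxE.
rewrite mulr_sumr; apply: eq_bigr => i _; rewrite mulr_sumr.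
by apply: eq_bigr => j _; rewrite mxE; ring.
Qed.

Lemma GamZr (x u w : V) (k : R) : Gam g x u (k *: w) = k *: Gam g x u w.
Proof.
rewrite /Gam scalerA mulrC -scalerA; congr (_ *: _).
rewrite scalemxAl; congr (_ *m _); apply/rowP => l; rewrite !mxE.
rewrite mulr_sumr; apply: eq_bigr => i _; rewrite mulr_sumr.
by apply: eq_bigr => j _; rewrite mxE; ring.
Qed.

Lemma covDZ (c W : R -> V) (k t : R) : derivable W t 1 ->
  covD g c (fun s => k *: W s) t = k *: covD g c W t.
Proof.
move=> dW; rewrite /covD GamZr scalerDr; congr (_ + _).
exact: (deriveZ k dW).
Qed.

(** The curve [d] need only agree with the reparametrized [c] near [u], because the chosen geodesics
    are compared on the unit interval only. *)
Lemma covD_affine (c d W : R -> V) (a b u : R) :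
  (\forall v \near u, c (a + v * b) = d v) ->
  derivable c (a + u * b) 1 -> derivable W (a + u * b) 1 ->
  covD g d (fun s => W (a + s * b)) u = b *: covD g c W (a + u * b).
Proof.
move=> cd dc dW.
have [_ vd] : is_derive u 1 d (b *: vel c (a + u * b)).
  exact: near_eq_is_derive cd (is_derive_comp_affine c a b u _ (derivableP dc)).
have [_ vW] := is_derive_comp_affine W a b u _ (derivableP dW).
by rewrite /covD vd vW GamZl scalerDr (nbhs_singleton cd).
Qed.

Lemma vel_affine (c : R -> V) (a b : R) : Ck setT 1 c ->
  vel (fun u => c (a + u * b)) = fun u => b *: vel c (a + u * b).
Proof.
move=> cC; apply/funext => u.
by have [_] := is_derive_comp_affine c a b u _ (Ck1_is_derive c _ cC).
Qed.

(** The velocity and its covariant derivative each pick up a factor [b], so the geodesic equation is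
    preserved. *)
Lemma geodesic_affine (c : R -> V) (x y : V) (a b : R) :
  (forall u : R, 0 <= u <= 1 -> 0 <= a + u * b <= 1) ->
  geodesic g c x y ->
  geodesic g (fun u : R => c (a + u * b)) (c a) (c (a + b)).
Proof.
move=> ab [cS [_ [_ cg]]]; have cC := smooth_on_Ck1 c cS.
have vC := smooth_on_vel c cS.
split; first by move=> k; exact: Ck_affine (cS k).
split; first by rewrite mul0r addr0.
split; first by rewrite mul1r.
move=> u /ab u01; rewrite vel_affine//.
have dv : derivable (vel c) (a + u * b) 1.
  by have [] := Ck1_is_derive (vel c) (a + u * b) vC.
have dc : derivable c (a + u * b) 1.
  by have [] := Ck1_is_derive c (a + u * b) cC.
rewrite covDZ; last by have [] := is_derive_comp_affine (vel c) a b u _ (derivableP dv).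
have cc : \forall v \near u, c (a + v * b) = c (a + v * b) by near=> v.
by rewrite (covD_affine c _ (vel c) a b u cc dc dv) cg// !scaler0.
Unshelve. all: by end_near. Qed.

(** Agreement on one side of 0 suffices: the velocities coincide just to the right of 0, and both
    are continuous. *)
Lemma vel_eq0_at_0 (c d : R -> V) : Ck setT 1 c -> Ck setT 1 d ->
  (forall t : R, 0 <= t <= 1 -> c t = d t) -> vel c 0 = vel d 0.
Proof.
move=> cC dC cd.
have A : vel c s @[s --> (0:R)^'+] --> vel c 0.
  exact: cvg_at_right_filter (Ck1_vel_continuous c cC 0).
have B : vel d s @[s --> (0:R)^'+] --> vel d 0.
  exact: cvg_at_right_filter (Ck1_vel_continuous d dC 0).
suff E : \forall s \near (0:R)^'+, vel d s = vel c s.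
  have B' : vel c s @[s --> (0:R)^'+] --> vel d 0.
    exact: cvg_trans (near_eq_cvg E) B.
  have := @cvg_unique _ (@norm_hausdorff _ V) _ _ _ _ A B'; exact.
near=> s; suff cds : \forall v \near s, d v = c v.
  exact: near_eq_derive cds.
near=> v; apply/esym/cd; apply/andP; split; apply: ltW; near: v.
  by apply: lt_nbhsr; near: s; exact: nbhs_right_gt.
by apply: lt_nbhsl; near: s; exact: nbhs_right_lt.
Unshelve. all: by end_near. Qed.

Hypothesis gP : riemannian_metric g.

(** Metric compatibility makes the derivative vanish inside the interval; continuity takes care of
    the endpoints. *)
Lemma mdot_parallel_constant (c A B : R -> V) (a b : R) : a <= b ->
  Ck setT 1 c -> Ck setT 1 A -> Ck setT 1 B ->
  (forall t : R, a < t < b -> covD g c A t = 0) ->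
  (forall t : R, a < t < b -> covD g c B t = 0) ->
  mdot g (c b) (A b) (B b) = mdot g (c a) (A a) (B a).
Proof.
move=> ab cC AC BC pA pB.
have dC (W : R -> V) t : Ck setT 1 W -> derivable W t 1.
  by move=> /(Ck1_is_derive W t)[].
apply: (constant_of_derive0 (fun t => mdot g (c t) (A t) (B t))) => // [t tab|t _].
  apply: is_derive_eq (is_derive_mdot g gP c A B t _ _ _) _; try exact: dC.
  by rewrite pA// pB// mdot0l mdot0r addr0.
exact: (continuous_mdot g c A B t gP (Ck1_continuous c cC t)
  (Ck1_continuous A AC t) (Ck1_continuous B BC t)).
Qed.

(** The velocity is parallel, so its Riemannian norm is constant; one zero would make the curve
    constant and force [x = y]. *)
Lemma geodesic_vel_neq0 (c : R -> V) (x y : V) (t : R) : geodesic g c x y ->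
  x != y -> 0 <= t <= 1 -> vel c t != 0.
Proof.
move=> [cS [<- [<- cg]]] + /andP[t0 t1]; apply: contraNN => /eqP vt.
have cC := smooth_on_Ck1 c cS; have vC := smooth_on_vel c cS.
have K (a b : R) : 0 <= a -> a <= b -> b <= 1 ->
    mdot g (c b) (vel c b) (vel c b) = mdot g (c a) (vel c a) (vel c a).
  by move=> a0 ab b1; apply: mdot_parallel_constant => // s sab; apply: cg; lra.
have v0 s : 0 <= s <= 1 -> vel c s = 0.
  move=> /andP[s0 s1]; apply/eqP; rewrite -(mdot_eq0 g gP (c s)).
  have [st|/ltW ts] := leP s t; first by rewrite -(K s t)// vt mdot0l.
  by rewrite (K t s)// vt mdot0l.
apply/eqP/rowP => i.
apply/esym/(constant_of_derive0 (fun s => c s 0 i)) => // [s s01|s s01].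
  have /is_derive_rowP/(_ i) := Ck1_is_derive c s cC.
  by rewrite v0 ?mxE//; lra.
have /is_derive_rowP/(_ i) := Ck1_is_derive c s cC.
exact: is_derive_continuous.
Qed.

End Geodesics.

(** * Uniqueness of geodesics, the adjoint of parallel transport, and Euclidean facts *)

Section Transport.
Context {R : realType} {n : nat}.
Notation V := 'rV[R]_n.
Variables (g : V -> 'M[R]_n) (M : set V) (gam : V -> V -> R -> V).
Variable P : V -> V -> V -> V.
Hypotheses (gP : riemannian_metric g) (gamP : unique_min_geodesics g M gam).
Hypotheses (Mconv : geod_convex M gam) (PP : parallel_transport g gam M P).

Lemma gam_geodesic (x y : V) : M x -> M y -> geodesic g (gam x y) x y.
Proof. by move=> Mx /(gamP x y Mx)[]. Qed.

Lemma gam_Ck1 (x y : V) : M x -> M y -> Ck setT 1 (gam x y).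
Proof. by move=> Mx My; have [/smooth_on_Ck1] := gam_geodesic x y Mx My. Qed.

Lemma gam_reverse (x y : V) (t : R) : M x -> M y -> 0 <= t <= 1 ->
  gam y x t = gam x y (1 + t * -1).
Proof.
move=> Mx My t01; have [gxy mxy _] := gamP x y Mx My.
have [_ [c0 [c1 _]]] := gxy.
have gyx : geodesic g (fun u => gam x y (1 + u * -1)) y x.
  have := geodesic_affine g (gam x y) x y 1 (-1) _ gxy.
  by rewrite subrr c0 c1; apply => u ?; lra.
have myx := minimizing_reverse g gP (gam x y) x y (gam_Ck1 x y Mx My) mxy.
have [_ _ yx] := gamP y x My Mx.
by rewrite -(yx _ gyx myx t t01).
Qed.

Lemma gam_restrict (x y : V) (t s : R) : M x -> M y -> 0 <= t <= 1 ->
  0 <= s <= 1 -> gam (gam x y t) y s = gam x y (t + s * (1 - t)).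
Proof.
move=> Mx My t01 s01; have [gxy mxy _] := gamP x y Mx My.
have [_ [c0 [c1 _]]] := gxy.
have gzy : geodesic g (fun u => gam x y (t + u * (1 - t))) (gam x y t) y.
  have := geodesic_affine g (gam x y) x y t (1 - t) _ gxy.
  by rewrite [t + (1 - t)]addrC subrK c1; apply => u ?; nra.
have mzy := minimizing_restrict g gP (gam x y) x y t (gam_Ck1 x y Mx My) c0 c1 t01 mxy.
have [_ _ zy] := gamP (gam x y t) y (Mconv x y Mx My t t01) My.
by rewrite -(zy _ gzy mzy s s01).
Qed.

Lemma rlog_reverse (x y : V) : M x -> M y -> rlog gam y x = - vel (gam x y) 1.
Proof.
move=> Mx My; rewrite /rlog.
have cC := gam_Ck1 x y Mx My; have rC := Ck1_affine (gam x y) 1 (-1) cC.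
rewrite (vel_eq0_at_0 (gam y x) _ (gam_Ck1 y x My Mx) rC).
  by rewrite vel_affine// mul0r addr0 scaleN1r.
by move=> t t01; exact: gam_reverse.
Qed.

Lemma dot2C (u v : V) : dot2 u v = dot2 v u.
Proof. by rewrite /dot2 -[in LHS](trmxK u) -trmx_mul mxE. Qed.

(* [Y] is the parallel field along the geodesic from x to y ending at the vector
   that represents [dot2 ^~ u] for the metric at y. *)
Lemma transport_adjoint (x y u : V) : M x -> M y ->
  exists Y : R -> V, [/\ Ck setT 1 Y,
    forall t : R, 0 < t < 1 -> covD g (gam x y) Y t = 0,
    forall eta : V, mdot g y eta (Y 1) = dot2 eta u &
    forall (t : R) (eta : V), 0 <= t < 1 ->
      mdot g (gam x y t) eta (Y t) = dot2 (P y (gam x y t) eta) u].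
Proof.
(* [z] is the Riesz representative of [dot2 ^~ u] for the metric at [y]. *)
move=> Mx My; set z := u *m invmx (g y).
have dotz eta : mdot g y eta z = dot2 eta u.
  by rewrite mdotC// /mdot mulmxKV ?metric_unitmx// dot2C.
have [W [WC W0 _ Wp]] := PP y x z My Mx.
have cC := gam_Ck1 x y Mx My; have rC := gam_Ck1 y x My Mx.
(* [W] carries [z] from [y] to [x]; run backwards, it is parallel along the geodesic from [x] to [y]
   and ends at [z]. *)
pose Y t := W (1 + t * -1).
have YC : Ck setT 1 Y by exact: Ck1_affine.
have Y1 : Y 1 = z by rewrite /Y mul1r subrr.
have Yp t : 0 < t < 1 -> covD g (gam x y) Y t = 0.
  move=> /andP[t0 t1]; rewrite (covD_affine g (gam y x)).
  - by rewrite Wp ?scaler0//; lra.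
  (* The reversal formula holds on the unit interval only; an interior [t] has a whole neighbourhood
     in it. *)
  - near=> v; have v01 : 0 <= v <= 1.
      apply/andP; split; apply: ltW; near: v; [exact: lt_nbhsr|exact: lt_nbhsl].
    rewrite (gam_reverse x y)//; last lra.
    by congr gam; ring.
  - by have [] := Ck1_is_derive (gam y x) (1 + t * -1) rC.
  - by have [] := Ck1_is_derive W (1 + t * -1) WC.
exists Y; split=> // [eta|t eta /andP[t0 t1]]; first by rewrite Y1.
have t01 : 0 <= t <= 1 by rewrite t0 ltW.
have Mz := Mconv x y Mx My t t01; set c := gam x y t in Mz *.
have [S [SC S0 S1 Sp]] := PP c y eta Mz My.
have [_ [d0 [d1 _]]] := gam_geodesic c y Mz My.
(* [S] and the restricted [Y] are parallel along the geodesic from [c] to [y]. Their product is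
   [mdot g c eta (Y t)] at 0 and pairs the transported [eta] with [z] at 1. *)
have := mdot_parallel_constant g gP (gam c y) S (fun s => Y (t + s * (1 - t)))
  0 1 ler01 (gam_Ck1 c y Mz My) SC (Ck1_affine _ _ _ YC).
rewrite d0 d1 S0 S1 mul0r addr0 mul1r [t + (1 - t)]addrC subrK Y1 dotz.
move=> -> // s s01; first by apply: Sp; lra.
have /andP[s0 s1] := s01.
rewrite (covD_affine g (gam x y)).
- by rewrite Yp ?scaler0//; nra.
- near=> v; have v01 : 0 <= v <= 1.
    apply/andP; split; apply: ltW; near: v; [exact: lt_nbhsr|exact: lt_nbhsl].
  by rewrite gam_restrict.
- by have [] := Ck1_is_derive (gam x y) (t + s * (1 - t)) cC.
- by have [] := Ck1_is_derive Y (t + s * (1 - t)) YC.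
Unshelve. all: by end_near. Qed.

Lemma dot2E (u v x : V) : dot2 u v = mdot (fun=> 1%:M) x u v.
Proof. by rewrite /mdot mulmx1. Qed.

Lemma Ck_cst (U W : normedModType R) (D : set U) (k : nat) (w : W) :
  Ck D k (fun=> w).
Proof.
elim: k w => [|k IH] w /=; first by move=> x _; exact: cst_continuous.
split=> [x _|v]; first exact: differentiable_cst.
suff -> : (fun x : U => 'D_v (fun=> w) x) = (fun=> 0) by exact: IH.
by apply/funext => x; exact: derive_cst.
Qed.

(** Definiteness of [dot2], and continuity and differentiability of the Euclidean speed, become
    instances of the Riemannian lemmas. *)
Lemma euclidean_metric : riemannian_metric (fun=> 1%:M : 'M[R]_n).
Proof.
split; first by move=> i j k; exact: Ck_cst.
split=> [_|_ v v0]; first by rewrite trmx1.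
rewrite mulmx1 mxE lt_neqAle; apply/andP; split; last first.
  by apply: sumr_ge0 => i _; rewrite mxE -expr2 sqr_ge0.
apply: contraNneq v0 => /esym/eqP; rewrite psumr_eq0 => [|i _]; last first.
  by rewrite mxE -expr2 sqr_ge0.
move=> /allP v0; apply/eqP/rowP => i.
by have := v0 i (mem_index_enum i); rewrite !mxE mulf_eq0 orbb => /eqP.
Qed.

Lemma dot2_ge0 (u : V) : 0 <= dot2 u u.
Proof.
have [->|u0] := eqVneq u 0; first by rewrite (dot2E _ _ 0) mdot0l.
by rewrite (dot2E _ _ 0) ltW// (mdot_gt0 _ euclidean_metric).
Qed.

Lemma norm2_ge0 (u : V) : 0 <= norm2 u. Proof. exact: sqrtr_ge0. Qed.

Lemma norm2_sqr (u : V) : norm2 u ^+ 2 = dot2 u u.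
Proof. by rewrite sqr_sqrtr// dot2_ge0. Qed.

Lemma norm2_gt0 (u : V) : u != 0 -> 0 < norm2 u.
Proof.
by move=> u0; rewrite sqrtr_gt0 (dot2E _ _ 0) (mdot_gt0 _ euclidean_metric).
Qed.

Lemma norm2N (u : V) : norm2 (- u) = norm2 u.
Proof.
by rewrite /norm2 !(dot2E _ _ 0) -scaleN1r mdotZl mdotZr; congr Num.sqrt; ring.
Qed.

Lemma dot2Dl (u v w : V) : dot2 (u + v) w = dot2 u w + dot2 v w.
Proof. by rewrite !(dot2E _ _ 0) mdotDl. Qed.

Lemma dot2Zl (k : R) (u v : V) : dot2 (k *: u) v = k * dot2 u v.
Proof. by rewrite !(dot2E _ _ 0) mdotZl. Qed.

Lemma dot2Zr (k : R) (u v : V) : dot2 u (k *: v) = k * dot2 u v.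
Proof. by rewrite !(dot2E _ _ 0) mdotZr. Qed.

Lemma dot2_inj (u v : V) : (forall w, dot2 u w = dot2 v w) -> u = v.
Proof.
move=> uv; apply/eqP; rewrite -subr_eq0 -(mdot_eq0 _ euclidean_metric 0) -dot2E.
by rewrite dot2Dl uv -scaleN1r dot2Zl mulN1r subrr.
Qed.

Lemma Cauchy_Schwarz_dot2 (u v : V) : dot2 u v <= norm2 u * norm2 v.
Proof.
have [->|v0] := eqVneq v 0.
  by rewrite (dot2E _ _ 0) mdot0r mulr_ge0// norm2_ge0.
have nv := norm2_gt0 v v0; have nu := norm2_ge0 u.
(* The squared norm of this vector is [norm2 v ^+ 2] times the gap in the squared inequality. *)
have := dot2_ge0 (norm2 v ^+ 2 *: u - dot2 u v *: v).
rewrite -scaleNr !dot2Dl !dot2Zl ![dot2 _ (_ + _)]dot2C !dot2Dl !dot2Zl.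
rewrite (dot2C v u) -!norm2_sqr.
set a := norm2 u in nu *; set b := norm2 v in nv *; set k := dot2 u v.
rewrite (_ : _ + _ = b ^+ 2 * ((a * b) ^+ 2 - k ^+ 2)); last by ring.
rewrite pmulr_rge0 ?exprn_gt0// subr_ge0 => kab.
rewrite leNgt; apply/negP => abk.
by move: kab; rewrite leNgt => /negP; apply; rewrite ltrXn2r// mulr_ge0// ltW.
Qed.

(** The adjoint formula at time 0 writes [dot2 (P y x eta) w] as [mdot g x eta (Y 0)], with [Y]
    independent of [eta], hence homogeneous in [eta]. *)
Lemma transportZ (x y : V) (k : R) (eta : V) : M x -> M y ->
  P y x (k *: eta) = k *: P y x eta.
Proof.
move=> Mx My; apply: dot2_inj => w.
have [Y [_ _ _ Yt]] := transport_adjoint x y w Mx My.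
have [_ [c0 _]] := gam_geodesic x y Mx My.
have Y0 e : mdot g x e (Y 0) = dot2 (P y x e) w.
  by have := Yt 0 e; rewrite c0; apply; rewrite lexx ltr01.
by rewrite dot2Zl -!Y0 mdotZl.
Qed.

End Transport.

(** * Integration of the local bounds along a geodesic *)

Section LocalToGlobal.
Context {R : realType} {n : nat}.
Notation V := 'rV[R]_n.
Variables (g : V -> 'M[R]_n) (M : set V) (gam : V -> V -> R -> V).
Variables (P : V -> V -> V -> V) (xi : V -> V).
Hypotheses (gP : riemannian_metric g) (gamP : unique_min_geodesics g M gam).
Hypotheses (Mconv : geod_convex M gam) (PP : parallel_transport g gam M P).
Hypothesis xi_smooth :
  exists U : set V, [/\ open U, M `<=` U & smooth_on U xi].

Lemma norm2_speed (c : R -> V) (t : R) :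
  norm2 (vel c t) = speed (fun=> 1%:M) c t.
Proof. by rewrite /speed -dot2E. Qed.

Lemma diso_ge0 (x y : V) : 0 <= diso gam x y.
Proof. by apply: Rintegral_ge0 => s _; exact: norm2_ge0. Qed.

Lemma local_to_global (x y u : V) (k : R) : M x -> M y -> x != y ->
  (forall t : R, 0 < t < 1 ->
    k <= dot2 (P y (gam x y t) (nabla_iso g gam xi x y t)) u) ->
  k * diso gam x y <=
    norm2 (rlog gam y x) * dot2 (xi y - P_iso gam P y x (xi x)) u.
Proof.
move=> Mx My xy hk; set c := gam x y.
(* Closing algebra: the [a], [b] and [n] stand for the values at 0 and 1 of [f], of [F] and of the
   Euclidean speed [N]. *)
have alg (a0 a1 b0 b1 n0 n1 e q : R) : a0 = n0 * q -> a1 = n1 * e -> 0 < n1 ->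
    a0 - k * b0 <= a1 - k * b1 -> k * (b1 - b0) <= n1 * (e - n0 / n1 * q).
  move=> -> -> n1_gt0; have -> : n1 * (e - n0 / n1 * q) = n1 * e - n0 * q.
    by field; rewrite gt_eqF.
  lra.
have cg : geodesic g c x y := gam_geodesic g M gam gamP x y Mx My.
have [cS [c0 [c1 _]]] := cg.
have cC := smooth_on_Ck1 c cS; have vC := smooth_on_vel c cS.
have [Y [YC Yp Y1 Yt]] := transport_adjoint g M gam P gP gamP Mconv PP x y u Mx My.
pose N (t : R) := norm2 (vel c t).
have NE : N = speed (fun=> 1%:M) c.
  by apply/funext => t; exact: norm2_speed.
have N_gt0 (t : R) : 0 <= t <= 1 -> 0 < N t.
  by move=> t01; apply: norm2_gt0; exact: geodesic_vel_neq0 cg xy t01.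
have dN (t : R) : 0 <= t <= 1 -> derivable N t 1.
  move=> t01.
  have [dv _] := Ck1_is_derive (vel c) t vC; have [dc _] := Ck1_is_derive c t cC.
  have dq := is_derive_mdot (fun=> 1%:M) euclidean_metric c (vel c) (vel c) t dc dv dv.
  (* The square root is differentiable here because the velocity never vanishes. *)
  have q0 : 0 < mdot (fun=> 1%:M) (c t) (vel c t) (vel c t).
    by rewrite -sqrtr_gt0; have := N_gt0 t t01; rewrite NE.
  have [+ _] := is_derive_comp1 _ _ _ _ _ dq (is_derive1_sqrt q0).
  by rewrite NE.
pose W (t : R) := N t *: xi (c t).
have dW (t : R) : 0 <= t <= 1 -> derivable W t 1.
  move=> t01; have Mc : M (c t) by exact: Mconv.
  have [U [_ MU /(_ 1%N)[/(_ (c t) (MU _ Mc)) dxi _]]] := xi_smooth.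
  have dx := is_derive_comp_differentiable c xi t _ (Ck1_is_derive c t cC) dxi.
  have /is_derive_rowP dxr := dx.
  apply/derivable_mxP => i j; rewrite ord1.
  have -> : (fun s => W s 0 j) = (fun s => N s * xi (c s) 0 j).
    by apply/funext => s; rewrite mxE.
  by have [] := is_derive_mul _ _ t _ _ (derivableP (dN t t01)) (dxr j).
pose f (t : R) := mdot g (c t) (W t) (Y t).
have df (t : R) : 0 <= t <= 1 -> is_derive t 1 f
    (mdot g (c t) (covD g c W t) (Y t) + mdot g (c t) (W t) (covD g c Y t)).
  move=> t01; have [dc _] := Ck1_is_derive c t cC.
  have [dY _] := Ck1_is_derive Y t YC.
  exact: (is_derive_mdot g gP c W Y t dc (dW t t01) dY).
have covW (t : R) : 0 <= t <= 1 -> covD g c W t = N t *: nabla_iso g gam xi x y t.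
  move=> t01; have N0 : N t != 0 by rewrite (gt_eqF (N_gt0 t t01)).
  have -> : nabla_iso g gam xi x y t = (N t)^-1 *: covD g c W t by [].
  by rewrite scalerA (divff N0) scale1r.
have cN : continuous N by rewrite NE; exact: speed_continuous euclidean_metric _ cC.
have [F dF] := continuous_antiderivative N cN.
have dE : diso gam x y = F 1 - F 0 by exact: Rintegral_antiderivative.
(* Subtracting [k * F] turns the integrated lower bound into monotonicity of [h]. *)
pose h (t : R) := f t - k * F t.
have dh (t : R) : 0 <= t <= 1 -> is_derive t 1 h
    (mdot g (c t) (covD g c W t) (Y t) + mdot g (c t) (W t) (covD g c Y t) -
     k * N t).
  move=> t01; apply: is_deriveB; first exact: df.
  exact: (is_deriveZ k (dF t t01)).
have h01 : h 0 <= h 1.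
  apply: (@ger0_derive1_ndecr _ h 0 1) => //.
  - move=> t; rewrite in_itv/= => /andP[t0 t1].
    by have [] := dh t; rewrite ?ltW.
  - move=> t; rewrite in_itv/= => t01; have /andP[t0 t1] := t01.
    have t01' : 0 <= t <= 1 by rewrite !ltW.
    rewrite derive1E; have [_ ->] := dh t t01'.
    (* [Y] being parallel, the derivative of [h] is [N t] times the excess over [k] in the local
       bound. *)
    rewrite Yp// mdot0r addr0 covW// mdotZl Yt; last by rewrite ltW.
    rewrite [k * _]mulrC -mulrBr mulr_ge0//; first by rewrite ltW// N_gt0.
    by rewrite subr_ge0 hk.
  - apply: continuous_within_segment => t t01.
    exact: is_derive_continuous (dh t t01).
have N1 : N 1 = norm2 (rlog gam y x).
  by rewrite (rlog_reverse g M gam gP gamP)// norm2N.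
have N1_gt0 : 0 < N 1 by apply: N_gt0; rewrite ler01 lexx.
have f1 : f 1 = N 1 * dot2 (xi y) u.
  by rewrite /f /W c1 mdotZl Y1.
have f0 : f 0 = N 0 * dot2 (P y x (xi x)) u.
  have E : mdot g (c 0) (xi (c 0)) (Y 0) = dot2 (P y (c 0) (xi (c 0))) u.
    by apply: Yt; rewrite lexx ltr01.
  have -> : f 0 = N 0 * mdot g (c 0) (xi (c 0)) (Y 0) by exact: mdotZl.
  by rewrite E c0.
set p := dot2 (P y x (xi x)) u in f0.
(* The weight in [P_iso] is the ratio of the Euclidean speeds of [c] at its two ends. *)
have -> : dot2 (xi y - P_iso gam P y x (xi x)) u = dot2 (xi y) u - N 0 / N 1 * p.
  by rewrite dot2Dl -scaleN1r dot2Zl mulN1r dot2Zl N1.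
rewrite -N1 dE.
exact: (alg _ _ _ _ _ _ _ _ f0 f1 N1_gt0 h01).
Qed.

Lemma strongly_iso_monotone_of_local (a : R) :
  loc_strongly_iso_monotone g gam P M xi a ->
  strongly_iso_monotone gam P M xi a.
Proof.
move=> loc x y Mx My xy; set u := P y x (rlog gam x y).
have alg (l l' d D : R) : 0 < l -> 0 < l' -> 0 <= d ->
    a * l' ^+ 2 * d <= l' * D -> a * d ^+ 2 <= l / l' * (d / l) * D.
  move=> l_gt0 l'_gt0 d_ge0 le_D.
  have -> : l / l' * (d / l) * D = d / l' ^+ 2 * (l' * D).
    by field; rewrite !gt_eqF.
  (* Both sides of the integrated bound are multiplied by [d / l' ^+ 2], which is nonnegative. *)
  have -> : a * d ^+ 2 = d / l' ^+ 2 * (a * l' ^+ 2 * d).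
    by field; rewrite gt_eqF.
  by apply: ler_wpM2l => //; rewrite divr_ge0// sqr_ge0.
have lg0 (v w : V) : M v -> M w -> v != w -> 0 < norm2 (rlog gam v w).
  move=> Mv Mw vw; apply: norm2_gt0.
  apply: geodesic_vel_neq0 (gam_geodesic g M gam gamP v w Mv Mw) vw _ => //.
  by rewrite lexx ler01.
have l1 : 0 < norm2 (rlog gam x y) by exact: lg0.
have l2 : 0 < norm2 (rlog gam y x) by apply: lg0 => //; rewrite eq_sym.
have H : a * norm2 (rlog gam y x) ^+ 2 * diso gam x y <=
    norm2 (rlog gam y x) * dot2 (xi y - P_iso gam P y x (xi x)) u.
  apply: local_to_global => // t /andP[t0 t1].
  by apply: loc => //; rewrite !ltW.
(* By homogeneity of transport, the iso-transported iso-logarithm is a scalar multiple of [u]. *)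
rewrite {2}/P_iso /log_iso (transportZ g M gam P)// -/u scalerA dot2Zr.
exact: (alg _ _ _ _ l1 l2 (diso_ge0 x y) H).
Qed.

Lemma iso_Lipschitz_of_local (L : R) : 0 <= L ->
  loc_iso_Lipschitz g gam P M xi L -> iso_Lipschitz gam P M xi L.
Proof.
move=> L0 loc x y Mx My xy; set w := xi y - _.
have [->|w0] := eqVneq w 0.
  rewrite /norm2 (dot2E _ _ 0) mdot0l sqrtr0 mulr_ge0//; exact: diso_ge0.
have nw := norm2_gt0 w w0.
have l2 : 0 < norm2 (rlog gam y x).
  apply: norm2_gt0; apply: geodesic_vel_neq0 (gam_geodesic g M gam gamP y x My Mx) _ _.
  - exact: gP.
  - by rewrite eq_sym.
  - by rewrite lexx ler01.
(* Testing against [- w] turns the Cauchy-Schwarz upper bound into the required lower bound; the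
   factor [l * norm2 w], positive since [w] is nonzero, is then cancelled. *)
have := local_to_global x y (-1 *: w) (- (L * norm2 (rlog gam y x) * norm2 w)) Mx My xy.
rewrite -/w dot2Zr -norm2_sqr.
set l := norm2 (rlog gam y x) in l2 *; set d := diso gam x y.
move=> H; suff : l * norm2 w * norm2 w <= l * norm2 w * (L * d).
  by rewrite ler_pM2l// mulr_gt0.
suff : - (L * l * norm2 w) * d <= l * (-1 * norm2 w ^+ 2) by lra.
apply: H => t /andP[t0 t1]; rewrite dot2Zr mulN1r lerN2.
apply: le_trans (Cauchy_Schwarz_dot2 _ _) _.
by rewrite ler_wpM2r ?norm2_ge0//; apply: loc => //; rewrite !ltW.
Qed.

End LocalToGlobal.

Theorem mainTheorem2 (R : realType) (n : nat)
  (g : 'rV[R]_n -> 'M[R]_n) (M : set 'rV[R]_n)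
  (gam : 'rV[R]_n -> 'rV[R]_n -> R -> 'rV[R]_n)
  (P : 'rV[R]_n -> 'rV[R]_n -> 'rV[R]_n -> 'rV[R]_n)
  (xi : 'rV[R]_n -> 'rV[R]_n) :
  riemannian_metric g ->
  unique_min_geodesics g M gam ->
  geod_convex M gam ->
  parallel_transport g gam M P ->
  (exists U : set 'rV[R]_n, [/\ open U, M `<=` U & smooth_on U xi]) ->
  [/\ loc_iso_monotone g gam P M xi -> iso_monotone gam P M xi,
      forall a : R, 0 <= a ->
        loc_strongly_iso_monotone g gam P M xi a ->
        strongly_iso_monotone gam P M xi a &
      forall L : R, 0 <= L ->
        loc_iso_Lipschitz g gam P M xi L -> iso_Lipschitz gam P M xi L].
Proof.
move=> gP gamP Mconv PP xiS; split=> [loc|a _|L L0].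
(* Iso-monotonicity is the strong version with constant 0. *)
- have := strongly_iso_monotone_of_local g M gam P xi gP gamP Mconv PP xiS 0.
  move=> H x y Mx My xy; have := H _ x y Mx My xy; rewrite mul0r; apply.
  by move=> v w Mv Mw vw t t01; rewrite mul0r; exact: loc.
- exact: strongly_iso_monotone_of_local.
- exact: iso_Lipschitz_of_local.
Qed.
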